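(* Let $G=\langle S_k\mid K\rangle$ be a finitely generated semigroup as described in the context with $K$ primitive, and suppose $\sum_{j=1}^kK(s_i,s_j)=k$ for some $s_i\in S_k$. Let $\mathcal{A}$ be a finite alphabet and $X=X_{\mathbf{A}}\subseteq\mathcal{A}^G$ a Markov tree shift. Then the topological entropy of $X$ exists and \[h(X)=\lim_{n\to\infty}\frac{\log p_n}{|\Delta_n|}=h^{(s)}(X).\]
   Context: Let $K$ be a $k\times k$ matrix with entries in $\{0,1\}$ indexed by $S_k=\{s_1,\dots,s_k\}$, and let $G=\langle S_k\mid K\rangle$ be the semigroup generated by $S_k$ subject to the relations $s_is_j=1_G$ if and only if $K(s_i,s_j)=0$ ($1_G$ the identity). Every $g\in G$ has a unique minimal representation $g=g_1g_2\cdots g_n$ with $g_l\in S_k$ and $K(g_l,g_{l+1})=1$; its length is $|g|=n$ (with $|1_G|=0$). For $n\ge0$, $\Delta_n=\{h\in G:|h|\le n\}$, and for $g\in G$ the $n$-semiball is $\bar{\Delta}^{(g)}_n=\{gh: h\in G,\ |h|\le n,\ |gh|=|g|+|h|\}$. For a finite alphabet $\mathcal{A}$, a pattern is a map $u:H\to\mathcal{A}$ with $H\subset G$ finite; $u$ is accepted by $t\in\mathcal{A}^G$ if there is $g\in G$ with $t_{gh}=u_h$ for all $h\in H$. For a subset $X\subseteq\mathcal{A}^G$, $p_n$ is the number of patterns $u\in\mathcal{A}^{\Delta_n}$ accepted by some $t\in X$, and $p^{(g)}_n$ the number of patterns $u\in\mathcal{A}^{\bar{\Delta}^{(g)}_n}$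 accepted by some $t\in X$. Given a $k$-tuple $\mathbf{A}=(A_1,\dots,A_k)$ of $\{0,1\}$-matrices indexed by $\mathcal{A}$, the Markov tree shift is $X_{\mathbf{A}}=\{t\in\mathcal{A}^G: A_i(t_g,t_{gs_i})=1 \text{ for all } g\in G \text{ and } i \text{ with } |gs_i|=|g|+1\}$. The $i$th stem entropy is $h^{(s_i)}(X)=\limsup_{n\to\infty}\log p^{(s_i)}_n/|\bar{\Delta}^{(s_i)}_n|$; since $K$ is primitive these values all coincide, and $h^{(s)}(X)$ denotes their common value (the stem entropy). A nonnegative square matrix is primitive if some power has all entries positive. *)

(* Defs.v *)
From HB Require Import structures.
From mathcomp Require Import all_boot all_order all_algebra.
From mathcomp Require Import all_classical all_reals all_analysis.
Set Implicit Arguments. Unset Strict Implicit. Unset Printing Implicit Defensive.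
Import Order.TTheory GRing.Theory Num.Theory.

Section MarkovTree.
Variable k : nat.
Variable K : 'I_k -> 'I_k -> bool.

(* admissible (minimal) words g_1 ... g_n with K(g_l,g_{l+1}) = 1;
   elements of G are identified with these words, 1_G = [::] *)
Definition adm (w : seq 'I_k) : bool := sorted K w.

(* right multiplication of a reduced word by a generator s_x:
   the relation s_y s_x = 1_G is applied iff K(s_y,s_x) = 0 *)
Definition pushG (w : seq 'I_k) (x : 'I_k) : seq 'I_k :=
  match rev w with
  | y :: r => if K y x then rcons w x else rev r
  | [::] => [:: x]
  end.

Definition mulG (g h : seq 'I_k) : seq 'I_k := foldl pushG g h.

Fixpoint allw (n : nat) : seq (seq 'I_k) :=
  match n with
  | 0 => [:: [::]]
  | n'.+1 => [::] :: [seq x :: w | x <- enum 'I_k, w <- allw n']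
  end.

Definition Delta (n : nat) : seq (seq 'I_k) := seq.filter adm (allw n).

Definition semiball (g : seq 'I_k) (n : nat) : seq (seq 'I_k) :=
  [seq mulG g h | h <- Delta n & size (mulG g h) == size g + size h].

Variable alph : finType.
Variable A : 'I_k -> alph -> alph -> bool.

(* configurations t in alph^G (values on non-admissible words irrelevant) *)
Definition markov_shift (t : seq 'I_k -> alph) : Prop :=
  forall g, adm g -> forall i : 'I_k,
    size (mulG g [:: i]) = (size g).+1 -> A i (t g) (t (mulG g [:: i])).

Definition npatterns (H : seq (seq 'I_k)) : nat :=
  #|[set u : {ffun 'I_(size H) -> alph} |
     `[< exists t, markov_shift t /\ exists g, adm g /\
          forall j : 'I_(size H), t (mulG g (nth [::] H j)) = u j >] ]|.

Definition p_n (n : nat) : nat := npatterns (Delta n).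
Definition p_stem (i : 'I_k) (n : nat) : nat := npatterns (semiball [:: i] n).

End MarkovTree.

Definition primitive k (K : 'I_k -> 'I_k -> bool) : Prop :=
  exists m : nat, forall i j : 'I_k,
    (0 < ((\matrix_(a < k, b < k) ((K a b : nat)%:Z)) ^+ m) i j)%R.

(* Main.v *)
(** Acceptance of patterns is translation invariant, even through
    cancellations, so the logarithms [a_i(n)] of the stem pattern counts satisfy
    [a_i(n+1) <= c + sum_(K i j) a_j(n)], while the semiball sizes satisfy
    [b_i(n+1) = 1 + sum_(K i j) b_j(n)]. For [k > 1], adding to [a] a constant
    vector [v] with [K v >= v + c] removes [c]; then [max_i a_i(n) / b_i(n)] is
    nonincreasing, and primitivity forces every ratio to stay close to this
    maximum, so all stem ratios converge to its limit. For [k = 1] this is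
    Fekete's lemma. A full row [i] of [K] makes the [i]-semiball a translate of
    [Delta_n], which bounds [p_n] from below by the [i]th stem count, and
    decomposing [Delta_n] into semiballs bounds it from above. *)

Require Import Defs.
From HB Require Import structures.
From mathcomp Require Import all_boot all_order all_algebra.
From mathcomp Require Import lra.
From mathcomp Require Import all_classical all_reals all_analysis.
Set Implicit Arguments. Unset Strict Implicit. Unset Printing Implicit Defensive.
Import Order.TTheory GRing.Theory Num.Theory.
Import numFieldNormedType.Exports.
Local Open Scope classical_set_scope.

Lemma ord_unary k (i j : 'I_k) : k <= 1 -> i = j.
Proof. by case: k i j => [[]//|[|k]] // i j _; rewrite (ord1 i) (ord1 j). Qed.

(** * Reduced words, semiballs and accepted patterns *)

Section Words.
Variables (k : nat) (K : 'I_k -> 'I_k -> bool).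
Implicit Types (g h w : seq 'I_k) (i j x y : 'I_k).

Lemma adm_rcons w y x : adm K (rcons (rcons w y) x) = adm K (rcons w y) && K y x.
Proof.
rewrite /adm; case: w => [|z w] /=; first by rewrite andbT.
by rewrite rcons_path last_rcons.
Qed.

Lemma pushG_rcons w y x :
  pushG K (rcons w y) x = if K y x then rcons (rcons w y) x else w.
Proof. by rewrite /pushG rev_rcons revK. Qed.

Lemma adm_pushG w x : adm K w -> adm K (pushG K w x).
Proof.
case/lastP: w => [//|w y] admw; rewrite pushG_rcons.
case: ifP => Kyx; first by rewrite adm_rcons admw.
by move: admw; rewrite /adm -cats1 => /cat_sorted2[].
Qed.

Lemma size_pushG w x : size (pushG K w x) <= (size w).+1.
Proof.
case/lastP: w => [//|w y]; rewrite pushG_rcons.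
by case: ifP => _; rewrite !size_rcons // ltnW.
Qed.

Lemma mulG_cat g w h : mulG K g (w ++ h) = mulG K (mulG K g w) h.
Proof. by rewrite /mulG foldl_cat. Qed.

Lemma adm_mulG g h : adm K g -> adm K (mulG K g h).
Proof. by elim: h g => [//|x h IH] g /(adm_pushG x) /IH. Qed.

Lemma size_mulG g h : size (mulG K g h) <= size g + size h.
Proof.
elim: h g => [|x h IH] g; first by rewrite addn0.
by rewrite /= addnS -addSn (leq_trans (IH _)) // leq_add2r size_pushG.
Qed.

(** Prefixes of an admissible word are admissible, so each letter is appended and nothing
    cancels. *)
Lemma mulG_reduced g h : adm K (g ++ h) -> mulG K g h = g ++ h.
Proof.
elim: h g => [|x h IH] g; first by rewrite cats0.
rewrite -cat_rcons => admgh.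
have -> : mulG K g (x :: h) = mulG K (pushG K g x) h by [].
suff -> : pushG K g x = rcons g x by exact: IH.
case/lastP: g admgh => [//|g y]; rewrite {1}/adm => /cat_sorted2[+ _].
by rewrite -/(adm K _) adm_rcons pushG_rcons => /andP[_ ->].
Qed.

(** * Balls and semiballs decomposed by the first letter *)

Lemma mem_allw n w : (w \in allw k n) = (size w <= n).
Proof.
elim: n w => [|n IH] [|x w] //=; rewrite in_cons /=.
apply/allpairsP/idP => [[[y v] /= [_ + [_ ->]]]|ltwn]; first by rewrite IH.
by exists (x, w); rewrite /= mem_enum IH.
Qed.

(** The length condition in [semiball] rejects exactly those [h] whose first letter is cancelled by
    [i], so products become plain concatenations. *)
Lemma semiballE i n :
  semiball K [:: i] n = [seq i :: h | h <- allw k n & adm K (i :: h)].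
Proof.
rewrite /semiball /Delta -filter_predI.
rewrite (_ : [seq h <- _ | _] = [seq h <- allw k n | adm K (i :: h)]).
  apply/eq_in_map => h; rewrite mem_filter => /andP[admh _].
  by rewrite mulG_reduced.
apply: eq_filter => h /=; apply/andP/idP => [[]|admih]; last first.
  split; last exact: (path_sorted admih).
  by rewrite (@mulG_reduced [:: i]).
case: h => [//|x h] + admh; rewrite /mulG /= (@pushG_rcons [::]).
case: ifP => [_ _|_]; first exact: admh.
(* If [K i x] fails, [i] and [x] cancel and the remaining product has length at most [size h], two
   short of what is required. *)
move=> /eqP eqs; have := size_mulG [::] h.
by rewrite /mulG eqs /= add1n add0n ltnNge leqnSn.
Qed.

Lemma mem_semiball i n w :
  w \in semiball K [:: i] n <->
  exists h, [/\ w = i :: h, size h <= n & adm K (i :: h)].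
Proof.
rewrite semiballE; split => [/mapP[h]|[h [-> sh admh]]].
  by rewrite mem_filter mem_allw => /andP[admh sh] ->; exists h.
by apply/mapP; exists h => //; rewrite mem_filter mem_allw admh.
Qed.

Lemma DeltaS n :
  Delta K n.+1 = [::] :: flatten [seq semiball K [:: x] n | x <- enum 'I_k].
Proof.
rewrite /Delta /= /allpairs_dep filter_flatten -map_comp; congr (_ :: flatten _).
by apply: eq_map => x /=; rewrite filter_map semiballE.
Qed.

Lemma semiballS i n :
  semiball K [:: i] n.+1 = [:: i] ::
    flatten [seq [seq i :: h | h <- semiball K [:: x] n] | x <- enum 'I_k & K i x].
Proof.
rewrite semiballE /= /allpairs_dep filter_flatten map_flatten; congr (_ :: _).
elim: (enum 'I_k) => [//|x s IH] /=; rewrite {}IH filter_map.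
case: ifP => Kix /=.
  congr ([seq i :: _ | _ <- _] ++ _); rewrite semiballE.
  by congr map; apply: eq_filter => h /=; rewrite /adm /= Kix.
by rewrite (@eq_filter _ _ pred0) ?filter_pred0 // => h; rewrite /= /adm /= Kix.
Qed.

Lemma semiball0 i : semiball K [:: i] 0 = [:: [:: i]].
Proof. by rewrite semiballE. Qed.

Lemma size_DeltaS n :
  size (Delta K n.+1) = (\sum_i size (semiball K [:: i] n)).+1.
Proof.
by rewrite DeltaS /= size_flatten sumnE big_map big_map big_enum.
Qed.

Lemma size_semiballS i n :
  size (semiball K [:: i] n.+1) = (\sum_(j | K i j) size (semiball K [:: j] n)).+1.
Proof.
rewrite semiballS /= size_flatten sumnE big_map big_map big_filter big_enum_cond.
by congr _.+1; apply: eq_bigr => j _; rewrite size_map.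
Qed.

Lemma semiball_full i n : (forall j, K i j) ->
  semiball K [:: i] n = [seq i :: h | h <- Delta K n].
Proof.
move=> Ki; rewrite semiballE; congr map; apply: eq_filter => -[//|x h].
by rewrite /adm /= Ki.
Qed.

(** * Accepted patterns and translation invariance *)

Variables (alph : finType) (A : 'I_k -> alph -> alph -> bool).

(** A view of a configuration from the base point [g], recorded on all words, reduced or not, so
    that moving the base point is prefixing a word. *)
Definition accepted (f : seq 'I_k -> alph) : Prop :=
  exists t, markov_shift K A t /\
    exists g, adm K g /\ forall h, f h = t (mulG K g h).

Lemma accepted_shift f w : accepted f -> accepted (fun h => f (w ++ h)).
Proof.
move=> [t [Xt [g [admg fE]]]]; exists t; split => //; exists (mulG K g w).
by split; [exact: adm_mulG | move=> h; rewrite fE mulG_cat].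
Qed.

Definition restr (H : seq (seq 'I_k)) (f : seq 'I_k -> alph) :
  {ffun 'I_(size H) -> alph} := [ffun j : 'I_(size H) => f (nth [::] H j)].

Lemma eq_restr H f1 f2 : restr H f1 = restr H f2 -> {in H, f1 =1 f2}.
Proof.
move=> /ffunP eqf h Hh; have ltH : index h H < size H by rewrite index_mem.
by have := eqf (Ordinal ltH); rewrite !ffunE /= nth_index.
Qed.

Definition pats H : {set {ffun 'I_(size H) -> alph}} :=
  [set u | `[< exists2 f, accepted f & u = restr H f >]].

Lemma npatternsE H : npatterns K A H = #|pats H|.
Proof.
apply: eq_card => u; rewrite !inE; apply/asbool_equiv_eq; split.
  move=> [t [Xt [g [admg tu]]]]; exists (fun h => t (mulG K g h)).
    by exists t; split => //; exists g.
  by apply/ffunP => j; rewrite ffunE tu.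
move=> [f [t [Xt [g [admg fE]]]] ->]; exists t; split => //; exists g; split => //.
by move=> j; rewrite ffunE fE.
Qed.

Lemma npatterns_nil : npatterns K A [::] <= 1.
Proof. by rewrite (leq_trans (max_card _)) // card_ffun card_ord expn0. Qed.

Lemma npatterns_seq1 h : npatterns K A [:: h] <= #|alph|.
Proof. by rewrite (leq_trans (max_card _)) // card_ffun card_ord expn1. Qed.

(* Translation invariance of acceptance: what is seen on w.H1 from g is seen on
   H1 from gw, even when gw involves cancellations. *)
Lemma npatterns_le_mul (H H1 H2 : seq (seq 'I_k)) w :
  {subset H <= [seq w ++ h | h <- H1] ++ H2} ->
  npatterns K A H <= npatterns K A H1 * npatterns K A H2.
Proof.
move=> sub; rewrite !npatternsE -cardsX.
have [->|[u0]] := set_0Vmem (pats H); first by rewrite cards0.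
rewrite inE => /asboolP[f0 _ _].
have /choice[F FP] u : exists f, u \in pats H -> accepted f /\ u = restr H f.
  have [|_] := boolP (u \in pats H); last by exists f0.
  by rewrite inE => /asboolP[f accf ->]; exists f.
(* [Phi] is injective on patterns because [w.H1] and [H2] cover [H]; its first component is a
   pattern on [H1] because views can be shifted by [w]. *)
pose Phi u := (restr H1 (fun h => F u (w ++ h)), restr H2 (F u)).
rewrite -(@card_in_imset _ _ Phi); last first.
  move=> u v /FP[_ uE] /FP[_ vE] [/eq_restr eq1 /eq_restr eq2].
  rewrite uE vE; apply/ffunP => j; rewrite !ffunE.
  have := sub _ (mem_nth [::] (ltn_ord j)).
  by rewrite mem_cat => /orP[/mapP[h Hh ->]|]; [exact: eq1 | exact: eq2].
apply/subset_leq_card/fintype.subsetP => _ /imsetP[u /FP[accF _] ->].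
rewrite !inE; apply/andP; split; apply/asboolP; last by exists (F u).
by exists (fun h => F u (w ++ h)) => //; exact: accepted_shift.
Qed.

(** * Recursive bounds for the pattern counts *)

Lemma npatterns_flatten w (S : 'I_k -> seq (seq 'I_k)) (r : seq 'I_k) :
  npatterns K A (flatten [seq [seq w ++ h | h <- S j] | j <- r])
  <= \prod_(j <- r) npatterns K A (S j).
Proof.
elim: r => [|j r IH]; first by rewrite big_nil npatterns_nil.
rewrite big_cons /=.
apply: (leq_trans (@npatterns_le_mul _ (S j) _ w (fun h Hh => Hh))).
by rewrite leq_mul2l IH orbT.
Qed.

Lemma npatterns_cons h H :
  npatterns K A (h :: H) <= #|alph| * npatterns K A H.
Proof.
rewrite (leq_trans (@npatterns_le_mul (h :: H) [:: h] H [::] _)) //.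
by rewrite leq_mul2r npatterns_seq1 orbT.
Qed.

Lemma p_nS n : p_n K A n.+1 <= #|alph| * \prod_i p_stem K A i n.
Proof.
rewrite /p_n DeltaS (leq_trans (npatterns_cons _ _)) // leq_mul2l.
have := npatterns_flatten [::] (fun x => semiball K [:: x] n) (enum 'I_k).
by rewrite big_enum (eq_map (fun j => map_id _)) => ->; rewrite orbT.
Qed.

Lemma p_stemS i n :
  p_stem K A i n.+1 <= #|alph| * \prod_(j | K i j) p_stem K A j n.
Proof.
rewrite /p_stem semiballS (leq_trans (npatterns_cons _ _)) // leq_mul2l.
have := npatterns_flatten [:: i] (fun x => semiball K [:: x] n)
  [seq x <- enum 'I_k | K i x].
by rewrite big_filter big_enum_cond => ->; rewrite orbT.
Qed.

Lemma p_stem_full i n : (forall j, K i j) -> p_stem K A i n <= p_n K A n.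
Proof.
move=> Ki; rewrite /p_stem semiball_full //.
rewrite (leq_trans (@npatterns_le_mul _ (Delta K n) [::] [:: i] _)) //.
  by rewrite cats0.
by rewrite -[leqRHS]muln1 leq_mul2l npatterns_nil orbT.
Qed.

(** With one generator all words are powers of it. Those in the large semiball have exponent at most
    [n + m + 2]; the ones above [n + 1] lie in the translate by the power [n + 1] of the semiball of
    radius [m]. *)
Lemma p_stem_unary i n m : k = 1 ->
  p_stem K A i (n + m).+1 <= p_stem K A i n * p_stem K A i m.
Proof.
move=> k1; have all_i (x : 'I_k) : x = i by apply: ord_unary; rewrite k1.
rewrite mulnC.
apply: (@npatterns_le_mul _ _ _ (nseq n.+1 i)) => _ /mem_semiball[h [-> sh admh]].
rewrite mem_cat; apply/orP; have [lehn|ltnh] := leqP (size h) n.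
  by right; apply/mem_semiball; exists h.
left; apply/mapP; exists (drop n h).
  apply/mem_semiball; exists (drop n.+1 h); split.
  - by rewrite (drop_nth i) // (all_i (nth _ _ _)).
  - by rewrite size_drop leq_subLR addSn.
  - rewrite -[X in X :: _](all_i (nth i h n)) -drop_nth //.
    move: (path_sorted admh); rewrite -{1}(cat_take_drop n h).
    by case/cat_sorted2.
rewrite /= -{1}(cat_take_drop n h); congr (_ :: _ ++ _).
have /all_pred1P -> : all (pred1 i) (take n h).
  by apply/allP => x _; rewrite /= (all_i x).
by rewrite size_takel // ltnW.
Qed.

End Words.
(** * Ratios of subharmonic and superharmonic sequences *)

Lemma cvg_shiftn_real (R : realType) (u : nat -> R) (N : nat) (l : R) :
  (fun n => u (n + N)%N) @ \oo --> l -> u @ \oo --> l.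
Proof. by move=> ul; have := @cvg_shiftn N _ u (nbhs l); move=> <-. Qed.

Section Ratio.
Local Open Scope ring_scope.
Variables (R : realType) (k : nat) (K : 'I_k -> 'I_k -> bool).
Implicit Types (f g : 'I_k -> R) (a b : nat -> 'I_k -> R) (i j : 'I_k) (n m N : nat).

(** The action of the matrix [K] on column vectors. *)
Definition succ_sum f i : R := \sum_(j | K i j) f j.

Lemma succ_sum_le f g : (forall i, f i <= g i) ->
  forall i, succ_sum f i <= succ_sum g i.
Proof. by move=> lefg i; apply: ler_sum. Qed.

Lemma iter_succ_sum_ge0 f n : (forall i, 0 <= f i) ->
  forall i, 0 <= iter n succ_sum f i.
Proof. by move=> f0; elim: n => [//|n IH] i /=; apply: sumr_ge0. Qed.

Lemma iter_succ_sum f n i :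
  iter n succ_sum f i =
  \sum_j (((\matrix_(a < k, b < k) ((K a b : nat)%:Z)) ^+ n) i j)%:~R * f j.
Proof.
elim: n i => [|n IH] i.
  rewrite expr0 (bigD1 i) //= big1 ?addr0 ?mxE ?eqxx ?mul1r // => j ji.
  by rewrite mxE eq_sym (negbTE ji) mul0r.
rewrite iterS /succ_sum (eq_bigr _ (fun q _ => IH q)) exchange_big /=.
apply: eq_bigr => j _; rewrite exprS mxE rmorph_sum /= mulr_suml big_mkcond /=.
apply: eq_bigr => q _; rewrite mxE rmorphM /=.
by case: (K i q); rewrite ?mul1r ?mul0r.
Qed.

(* The form in which primitivity is used: some power of K dominates the all-ones
   matrix. *)
Definition mixing N : Prop := forall f, (forall i, 0 <= f i) ->
  forall i, \sum_j f j <= iter N succ_sum f i.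

(** Positive entries of an integer matrix are at least 1. *)
Lemma primitive_mixing : primitive K -> exists N, mixing N.
Proof.
move=> [N KN]; exists N => f f0 i; rewrite iter_succ_sum; apply: ler_sum => j _.
by rewrite ler_peMl // ler1z -gtz0_ge1.
Qed.

(** Mixing is tested on the constant 1, whose total is [k]: exponent 0 would give [k <= 1], and a
    zero row would give [k <= 0]. *)
Lemma mixing_succ N : mixing N -> (1 < k)%N -> forall i, exists j, K i j.
Proof.
move=> mixN k1 i; have := mixN (fun=> 1) (fun=> ler01) i.
rewrite sumr_const card_ord; case: N {mixN} => [|N] /=.
  by rewrite lern1 leqNgt k1.
have [/existsP[j Kij] _|/existsPn noj] := boolP [exists j, K i j]; first by exists j.
rewrite /succ_sum big_pred0 ?lern0 => [/eqP k0|j]; last exact/negbTE/noj.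
by rewrite k0 in k1.
Qed.

Lemma iter_superharmonic a N n : (forall m i, succ_sum (a m) i <= a m.+1 i) ->
  forall i, iter N succ_sum (a n) i <= a (n + N)%N i.
Proof.
move=> sa; elim: N => [|N IH] i; first by rewrite addn0.
by rewrite addnS (le_trans _ (sa _ _)) //=; exact: succ_sum_le.
Qed.

(* The maximal ratio rho n is nonincreasing; the defect of a ratio at time n
   from rho n forces, through the mixing inequality, a drop of rho between n
   and n + N. *)
Lemma ratio_cvg_harmonic a b N (C : R) : (0 < k)%N -> mixing N ->
  (forall n i, 0 <= a n i) -> (forall n i, 0 < b n i) ->
  (forall n i, a n.+1 i <= succ_sum (a n) i) ->
  (forall n i, succ_sum (b n) i <= b n.+1 i) ->
  (forall n i j, b (n + N + N)%N i <= C * b (n + N)%N j) ->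
  exists L : R, forall i, (fun n => a n i / b n i) @ \oo --> L.
Proof.
move=> k0 mixN a0 b0 aS bS bC; pose i0 := Ordinal k0.
pose r n i := a n i / b n i.
pose im n := [arg max_(i > i0) r n i]%O; pose rho n := r n (im n).
have r_le n i : r n i <= rho n.
  by rewrite /rho /im; case: arg_maxP => // m _; exact.
have rho0 n : 0 <= rho n by rewrite divr_ge0 // ltW.
(* With [rho l] frozen, [z l] is superharmonic in [n] and nonnegative at time [l], hence nonnegative
   at all later times. *)
pose z l n i := rho l * b n i - a n i.
have zS l n i : succ_sum (z l n) i <= z l n.+1 i.
  rewrite /succ_sum /z sumrB -mulr_sumr lerB //.
  by rewrite ler_wpM2l // bS.
have zll l i : 0 <= z l l i by rewrite subr_ge0 -ler_pdivrMr // r_le.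
have z0 l m i : 0 <= z l (l + m)%N i.
  rewrite (le_trans _ (@iter_superharmonic (z l) m l (zS l) i)) //.
  exact: iter_succ_sum_ge0.
have rho_noninc : nonincreasing_seq rho.
  apply/nonincreasing_seqP => n.
  by rewrite {1}/rho ler_pdivrMr // -subr_ge0 -(addn1 n) z0.
have [L rhoL] : exists L : R, rho @ \oo --> L.
  exists (limn rho); apply: nonincreasing_is_cvgn => //.
  by exists 0 => _ [n _ <-]; exact: rho0.
exists L => j.
have defect n : rho (n + N)%N - r (n + N)%N j <=
    C * (rho (n + N)%N - rho (n + N + N)%N).
  (* Mixing bounds the defect at [j], weighted by [b l j], by [z l] at time [l + N] and the
     maximizing index [i], where it is the drop of [rho] times [b]. The constant [C] compares the
     two weights. *)
  set l := (n + N)%N; set i := im (l + N)%N.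
  have : z l l j <= z l (l + N)%N i.
    rewrite (le_trans _ (@iter_superharmonic (z l) N l (zS l) i)) //.
    rewrite (le_trans _ (mixN _ (zll l) i)) // (bigD1 j) //= lerDl.
    by apply: sumr_ge0.
  have zE : z l (l + N)%N i = (rho l - rho (l + N)%N) * b (l + N)%N i.
    by rewrite mulrBl /rho -/i divfK // gt_eqF.
  have -> : z l l j = (rho l - r l j) * b l j.
    by rewrite mulrBl /r divfK // gt_eqF.
  rewrite zE -ler_pdivlMr // => /le_trans; apply.
  rewrite ler_pdivrMr // [C * _]mulrC -mulrA ler_wpM2l //; last exact: bC.
  by rewrite subr_ge0 rho_noninc // leq_addr.
have rhoN m : (fun n => rho (n + m)%N) @ \oo --> L.
  by apply: cvg_comp rhoL; exact: cvg_addnr.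
apply: (@cvg_shiftn_real _ (fun n => a n j / b n j) N).
apply: (@squeeze_cvgr _ _ _ _
  (fun n => rho (n + N)%N - C * (rho (n + N)%N - rho (n + (N + N))%N))
  (fun n => rho (n + N)%N)) => //.
- by near=> n; rewrite r_le andbT lerBlDr -lerBlDl addnA defect.
- rewrite -[X in _ --> X]subr0 -[X in _ - X](mulr0 C) -[X in C * X](subrr L).
  by apply: cvgB => //; apply: cvgMl_tmp; apply: cvgB.
Unshelve. all: by end_near. Qed.

(** Reduction to the harmonic case: [a] is replaced by [a + v], which leaves the limit unchanged
    because [b] grows at least linearly. *)
Lemma ratio_cvg a b (c : R) N : (1 < k)%N -> mixing N -> 0 <= c ->
  (forall n i, 0 <= a n i) ->
  (forall n i, a n.+1 i <= c + succ_sum (a n) i) ->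
  (forall i, b 0%N i = 1) ->
  (forall n i, b n.+1 i = 1 + succ_sum (b n) i) ->
  (forall n i, n.+1%:R <= b n i) ->
  exists L : R, forall i, (fun n => a n i / b n i) @ \oo --> L.
Proof.
move=> k1 mixN c0 a0 aS b00 bS bn.
have k0 : (0 < k)%N by rewrite ltnW.
have b0 n i : 0 < b n i by rewrite (lt_le_trans _ (bn n i)) // ltr0Sn.
have bT n i : succ_sum (b n) i <= b n.+1 i by rewrite bS lerDr.
(* succ_sum v >= v + c, so adding v absorbs the additive constant *)
pose v i : R := c * \sum_(0 <= s < N) iter s succ_sum (fun=> 1) i.
have v0 i : 0 <= v i.
  by rewrite mulr_ge0 // sumr_ge0 // => s _; apply: iter_succ_sum_ge0.
(* By telescoping, [K v - v = c (K^N 1 - 1)], and mixing gives [K^N 1 >= k >= 2]. *)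
have vT i : v i + c <= succ_sum v i.
  rewrite /succ_sum /v -mulr_sumr -[X in _ + X]mulr1 -mulrDr ler_wpM2l //.
  rewrite exchange_big /= -lerBrDl -sumrB.
  rewrite (eq_bigr (fun s => iter s.+1 succ_sum (fun=> 1) i -
    iter s succ_sum (fun=> 1) i)) // telescope_sumr // lerBrDl /=.
  rewrite (le_trans _ (mixN _ _ i)) // sumr_const card_ord.
  by rewrite (_ : 1 + 1 = 2%:R) // ler_nat.
(* Comparability of the sizes: the total [B] grows by a factor at most [2k] per step, while mixing
   gives [b (n + N) j >= B n] for every [j]. *)
pose B n : R := \sum_i b n i.
have b_le n i : b n i <= B n.
  by rewrite /B (bigD1 i) //= lerDl sumr_ge0 // => j _; exact: ltW.
have B1 n : 1 <= B n.
  by rewrite (le_trans _ (b_le n (Ordinal k0))) // (le_trans _ (bn _ _)) // ler1n.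
have BS n : B n.+1 <= (2 * k)%:R * B n.
  rewrite natrM mulrAC mulr_natr -[k in leRHS]card_ord -sumr_const.
  apply: ler_sum => i _; rewrite bS mulr2n mulrDl mul1r lerD //.
  rewrite /succ_sum /B big_mkcond /=; apply: ler_sum => j _.
  by case: ifP => // _; exact: ltW.
have BD n m : B (n + m)%N <= (2 * k)%:R ^+ m * B n.
  elim: m => [|m IH]; first by rewrite addn0 mul1r.
  by rewrite addnS (le_trans (BS _)) // exprS -mulrA ler_wpM2l.
have [|||||L Lcvg] := @ratio_cvg_harmonic (fun n i => a n i + v i) b N
    ((2 * k)%:R ^+ (N + N)) k0 mixN.
- by move=> n i; rewrite addr_ge0.
- exact: b0.
- move=> n i; rewrite /succ_sum big_split /= -/(succ_sum _ i) -/(succ_sum _ i).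
  rewrite (le_trans (lerD (aS n i) (lexx _))) //.
  by rewrite addrAC addrC lerD2l addrC vT.
- exact: bT.
- move=> n i j; rewrite (le_trans (b_le _ _)) // -addnA (le_trans (BD _ _)) //.
  rewrite ler_wpM2l ?exprn_ge0 // (le_trans _ (@iter_superharmonic b N n bT j)) //.
  by apply: mixN => q; exact: ltW.
exists L => i.
have vb0 : (fun n => v i / b n i) @ \oo --> 0.
  apply: (@squeeze_cvgr _ _ _ _ (fun=> 0) (fun n => v i * n.+1%:R^-1)).
  - near=> n; apply/andP; split; first by rewrite divr_ge0 // ltW.
    by rewrite ler_wpM2l // lef_pV2 ?posrE ?ltr0Sn.
  - exact: cvg_cst.
  - by rewrite -[X in _ --> X](mulr0 (v i)); apply: cvgMl_tmp; exact: cvg_harmonic.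
rewrite -[X in _ --> X]subr0.
rewrite (_ : (fun n => _) = (fun n => (a n i + v i) / b n i - v i / b n i)).
  by apply: cvgB; [exact: Lcvg | exact: vb0].
by apply/funext => n; rewrite mulrDl addrK.
Unshelve. all: by end_near. Qed.

(** The index is shifted by one: [a n] is the value at [n + 1] of a subadditive sequence. The limit
    is the infimum of the ratios. *)
Lemma fekete (a : nat -> R) : (forall n, 0 <= a n) ->
  (forall n m, a (n + m).+1 <= a n + a m) ->
  exists L : R, (fun n => a n / n.+1%:R) @ \oo --> L.
Proof.
move=> a0 aD; pose r n := a n / n.+1%:R.
have infr : has_inf (range r).
  split; first by exists (r 0%N), 0%N.
  by exists 0 => _ [n _ <-]; rewrite divr_ge0.
have r_ge n : inf (range r) <= r n by apply: ge_inf; [exact: infr.2 | exists n].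
exists (inf (range r)); apply/cvgrPdist_le => e e0.
have [|_ [m _ <-] rm] := @inf_adherent _ (range r) (e / 2) _ infr.
  by rewrite divr_gt0.
pose D := \sum_(s < m.+1) a s.
(* Blocks of length [m + 1] are split off, each costing [a m = (m + 1) r m]; [D] bounds whatever
   remains once the index is at most [m]. *)
have a_le n : a n <= n.+1%:R * r m + D.
  have [l] := ubnP n; elim: l n => // l IH n; rewrite ltnS => lenl.
  have [lenm|ltmn] := leqP n m.
    rewrite (@le_trans _ _ D) //; last by rewrite lerDr mulr_ge0 // divr_ge0.
    rewrite /D (bigD1 (Ordinal (lenm : (n < m.+1)%N))) //= lerDl.
    by rewrite sumr_ge0.
  have {ltmn} [q nE] : exists q, n = (q + m).+1.
    by exists (n - m.+1)%N; rewrite -addnS subnK.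
  have aq : a q <= q.+1%:R * r m + D.
    by apply: IH; rewrite (leq_trans _ lenl) // nE ltnS leq_addr.
  rewrite nE (le_trans (aD _ _)) // (le_trans (lerD aq (lexx _))) //.
  rewrite -addSn -addnS natrD mulrDl addrAC lerD2r lerD2l.
  by rewrite mulrC divfK.
have : (fun n => D * n.+1%:R^-1) @ \oo --> D * 0.
  by apply: cvgMl_tmp; exact: cvg_harmonic.
rewrite mulr0 => /cvgrPdist_le /(_ (e / 2)) near_D.
near=> n.
have : `|0 - D * n.+1%:R^-1| <= e / 2.
  by near: n; apply: near_D; rewrite divr_gt0.
rewrite sub0r normrN ger0_norm; last by rewrite divr_ge0 // sumr_ge0.
move=> Dn; rewrite distrC ger0_norm; last by rewrite subr_ge0; exact: r_ge.
rewrite lerBlDr.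
rewrite (@le_trans _ _ (r m + D / n.+1%:R)) //.
  by rewrite ler_pdivrMr // mulrDl divfK // mulrC.
by rewrite (le_trans (lerD (ltW rm) Dn)) // -addrA -splitr addrC.
Unshelve. all: by end_near. Qed.

End Ratio.

(** * Entropies *)

(** Pattern counts vanish when the shift is empty; the default value [ln 0 = 0] covers that case
    here and below. *)
Lemma ln_nat_ge0 (R : realType) (x : nat) : (0 <= ln (x%:R : R))%R.
Proof. by case: x => [|x]; [rewrite ln0 | rewrite ln_ge0 // ler1n]. Qed.

Lemma ln_nat_le (R : realType) (x y : nat) : x <= y ->
  (ln (x%:R : R) <= ln (y%:R : R))%R.
Proof.
case: x => [|x] lexy; first by rewrite ln0 // ln_nat_ge0.
by rewrite ler_ln ?posrE ?ltr0n ?ler_nat // (leq_trans _ lexy).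
Qed.

Lemma ln_nat_le_mul (R : realType) (x y z : nat) : x <= y * z ->
  (ln (x%:R : R) <= ln (y%:R : R) + ln (z%:R : R))%R.
Proof.
case: x => [|x] lex; first by rewrite ln0 // addr_ge0 // ln_nat_ge0.
have : 0 < y * z by exact: leq_trans lex.
rewrite muln_gt0 => /andP[y0 z0].
by rewrite -lnM ?posrE ?ltr0n // -natrM ln_nat_le.
Qed.

Lemma ln_nat_prod (R : realType) (I : finType) (P : pred I) (F : I -> nat) :
  (ln ((\prod_(i | P i) F i)%N%:R : R) <= \sum_(i | P i) ln ((F i)%:R : R))%R.
Proof.
elim/big_rec2: _ => [|i y x _ IH]; first by rewrite ln1.
by rewrite (le_trans (ln_nat_le_mul _ (leqnn _))) // lerD2l.
Qed.

Section StemLimit.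
Local Open Scope ring_scope.
Variables (R : realType) (k : nat) (K : 'I_k -> 'I_k -> bool).
Variables (alph : finType) (A : 'I_k -> alph -> alph -> bool).

Let a n i : R := ln ((p_stem K A i n)%:R).
Let b n i : R := (size (semiball K [:: i] n))%:R.

Lemma size_semiball_ge n i : (forall i, exists j, K i j) -> n.+1%:R <= b n i.
Proof.
move=> succK; rewrite /b ler_nat.
elim: n i => [|n IH] i; first by rewrite semiball0.
have [j Kij] := succK i.
by rewrite size_semiballS ltnS (bigD1 j) //= (leq_trans (IH j)) // leq_addr.
Qed.

Lemma size_semiball_rec n i : b n.+1 i = 1 + succ_sum K (b n) i.
Proof. by rewrite /b size_semiballS -natr1 addrC natr_sum. Qed.

Lemma stem_entropy_cvg : primitive K -> (exists i, forall j, K i j) ->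
  exists L : R, forall i, (fun n => a n i / b n i) @ \oo --> L.
Proof.
move=> primK [i0 Ki0]; have k0 : (0 < k)%N by case: i0 {Ki0} => ? /(leq_trans _) ->.
have [k1|k1] := ltnP 1 k.
  have [N mixN] := primitive_mixing R primK.
  apply: (@ratio_cvg R k K a b (ln #|alph|%:R) N) => //.
  - exact: ln_nat_ge0.
  - by move=> n i; exact: ln_nat_ge0.
  - move=> n i; rewrite (le_trans (ln_nat_le_mul _ (p_stemS _ _ _ _))) // lerD2l.
    exact: ln_nat_prod.
  - exact: size_semiball_rec.
  - by move=> n i; apply: size_semiball_ge; exact: mixing_succ mixN k1.
(* With a single generator the full row makes the semiball of radius [n] a chain of [n + 1] words,
   and subadditivity applies. *)
have all_i0 (x : 'I_k) : x = i0 by exact: ord_unary.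
have {k0} k_eq1 : k = 1%N by apply/eqP; rewrite eqn_leq k1.
have [L aL] : exists L : R, (fun n => a n i0 / n.+1%:R) @ \oo --> L.
  apply: fekete => [n|n m]; first exact: ln_nat_ge0.
  by apply: ln_nat_le_mul; exact: p_stem_unary.
exists L => i; rewrite (all_i0 i) (_ : (fun n => _) = (fun n => a n i0 / n.+1%:R)) //.
apply/funext => n; congr (_ / _); elim: n => [|n IH]; first by rewrite /b semiball0.
rewrite size_semiball_rec /succ_sum (bigD1 i0) //= big1 => [|j]; last first.
  by rewrite (all_i0 j) eqxx andbF.
by rewrite addr0 IH -[n.+2]addn1 natrD addrC.
Qed.

(** Squeeze: from below by the [i0] stem ratio of the same radius, since the ball and this semiball
    have equal size; from above through the root and the semiballs of radius one less. *)
Lemma entropy_cvg (L : R) i0 : (forall i, exists j, K i j) -> (forall j, K i0 j) ->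
  (forall i, (fun n => a n i / b n i) @ \oo --> L) ->
  (fun n => ln ((p_n K A n)%:R : R) / (size (Delta K n))%:R) @ \oo --> L.
Proof.
move=> succK Ki0 aL.
apply: (@cvg_shiftn_real _
  (fun n => ln ((p_n K A n)%:R : R) / (size (Delta K n))%:R) 1).
have b0 n i : 0 < b n i by rewrite (lt_le_trans _ (size_semiball_ge n i succK)) // ltr0Sn.
pose s n : R := (size (Delta K n.+1))%:R.
have sE n : s n = 1 + \sum_i b n i.
  by rewrite /s size_DeltaS -natr1 addrC natr_sum.
have b_le n i : b n i <= s n.
  by rewrite sE (bigD1 i) //= addrCA lerDl addr_ge0 // sumr_ge0.
have s0 n : 0 < s n by exact: lt_le_trans (b0 n i0) (b_le n i0).
pose c : R := ln #|alph|%:R.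
have c0 : 0 <= c by exact: ln_nat_ge0.
(* The error has two sources: the root costs [c] in the pattern count and at most [|L|] in the size,
   divided by [s n >= n + 1]; each stem deviation has weight [b n i / s n <= 1]. *)
pose u n := (c + `|L|) * n.+1%:R^-1 + \sum_i `|a n i / b n i - L|.
apply: (@squeeze_cvgr _ _ _ _ (fun n => a (n + 1)%N i0 / b (n + 1)%N i0)
  (fun n => L + u n)).
- near=> n; apply/andP; split.
    rewrite /b semiball_full // size_map ler_wpM2r // ln_nat_le //.
    exact: p_stem_full.
  rewrite addn1 -/(s n) ler_pdivrMr //.
  have pn : ln (p_n K A n.+1)%:R <= c + \sum_i a n i.
    rewrite (le_trans (ln_nat_le_mul _ (p_nS _ _ _))) // lerD2l.
    exact: ln_nat_prod.
  rewrite (le_trans pn) //.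
  have -> : \sum_i a n i = \sum_i (a n i / b n i - L) * b n i + L * (s n - 1).
    rewrite sE addrAC subrr add0r mulr_sumr -big_split /=.
    by apply: eq_bigr => i _; rewrite mulrBl divfK ?subrK // gt_eqF.
  have le1 : \sum_i (a n i / b n i - L) * b n i <=
      (\sum_i `|a n i / b n i - L|) * s n.
    rewrite mulr_suml; apply: ler_sum => i _.
    rewrite (le_trans (ler_norm _)) // normrM ler_wpM2l //.
    by rewrite ger0_norm // ltW.
  have le2 : c + `|L| <= (c + `|L|) * n.+1%:R^-1 * s n.
    rewrite -mulrA ler_peMr ?addr_ge0 // mulrC ler_pdivlMr ?ltr0Sn // mul1r.
    exact: le_trans (size_semiball_ge n i0 succK) (b_le n i0).
  have le3 : - L <= `|L| by rewrite -normrN ler_norm.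
  rewrite /u mulrDl (mulrDl _ _ (s n)) mulrBr mulr1.
  rewrite (le_trans _ (lerD (lexx _) (lerD le2 le1))) //.
  move: (\sum_i _) (L * s n) c {c0 pn le2 u} => P Q c; lra.
- by have := @cvg_shiftn 1 _ (fun n => a n i0 / b n i0) (nbhs L); move=> ->.
- rewrite -[X in _ --> X]addr0; apply: cvgD; first exact: cvg_cst.
  rewrite -[X in _ --> X]addr0; apply: cvgD.
    rewrite -[X in _ --> X](mulr0 (c + `|L|)).
    by apply: cvgMl_tmp; exact: cvg_harmonic.
  rewrite [X in _ --> X](_ : _ = \sum_(i < k) `|L - L|); last first.
    by rewrite big1 // => i _; rewrite subrr normr0.
  apply: cvg_big => [|i _]; first exact: add_continuous.
  by apply: cvg_norm; apply: cvgB; [exact: aL | exact: cvg_cst].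
Unshelve. all: by end_near. Qed.

End StemLimit.

Unset Implicit Arguments.
Local Open Scope ring_scope.

Theorem theorem4p1 (R : realType) (k : nat) (K : 'I_k -> 'I_k -> bool)
  (alph : finType) (A : 'I_k -> alph -> alph -> bool) :
  primitive K ->
  (exists i : 'I_k, (\sum_(j < k) (K i j : nat))%N = k) ->
  exists L : R,
    ((fun n => ln ((p_n K A n)%:R : R) / (size (Delta K n))%:R) @ \oo --> L)
    /\ forall i : 'I_k,
      (L%:E = limn_esup
         (fun n => (ln ((p_stem K A i n)%:R : R)
                    / (size (semiball K [:: i] n))%:R)%:E))%E.
Proof.
move=> primK [i0 sumK].
(* A row sum equal to [k] leaves total 0 for the complementary entries. *)
have Ki0 j : K i0 j.
  have /eqP : (\sum_(j < k) ~~ K i0 j = 0)%N.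
    apply/eqP; rewrite -(eqn_add2l k) addn0 -{1}sumK -big_split /=.
    rewrite (eq_bigr (fun=> 1%N)) => [|i _]; last by case: (K i0 i).
    by rewrite sum_nat_const card_ord muln1.
  by rewrite sum_nat_eq0 => /forallP/(_ j); case: (K i0 j).
have [L stemL] := stem_entropy_cvg R A primK (ex_intro _ i0 Ki0).
exists L; split.
  apply: entropy_cvg stemL => // i.
  have [k1|k1] := ltnP 1 k.
    by have [N mixN] := primitive_mixing R primK; exact: mixing_succ mixN k1 i.
  by exists i0; rewrite (ord_unary i i0 k1).
(* The stem ratios converge, so their upper limit in the extended reals is the limit. *)
move=> i; apply/esym; apply: (cvg_limn_einf_sup _).2.
by apply: cvg_EFin (stemL i); near=> n.
Unshelve. all: by end_near. Qed.
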